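(* Let $G$ be a Polish group acting continuously on a Polish space $Z$, and let $G\curvearrowright Y$ be a Borel action on a standard Borel space $Y$. Let $\pi:Z\to Y$ be a Borel $G$-equivariant map. Let $H$ be a Polish group with a free continuous action $H\curvearrowright Z$ such that for all $z_1,z_2\in Z$, $\pi(z_1)=\pi(z_2)$ if and only if $z_1$ and $z_2$ lie in the same $H$-orbit. Let $\tau:G\curvearrowright H$ be a continuous action by automorphisms, and assume that the semidirect product $H\rtimes_\tau G$ acts continuously on $Z$, compatibly with the given actions: $(e_H,g)\cdot z=g\cdot z$ and $(h,e_G)\cdot z=h\cdot z$ for all $g\in G$, $h\in H$, $z\in Z$. If $G\curvearrowright Z$ is generically ergodic while $\tau:G\curvearrowright H$ is not, then there are no Borel $G$-equivariant inverses to $\pi: Z\to\pi(Z)$ (i.e., no Borel $G$-equivariant maps $\xi:\pi(Z)\to Z$ with $\pi(\xi(y))=y$ for all $y\in\pi(Z)$). Moreover, if $Y'\subseteq Y\cap\pi(Z)$ is a Borel $G$-invariant set such that $Z'=\pi^{-1}(Y')$ is comeager in $Z$, then there are no Borel $G$-equivariant inverses to $\pi|_{Z'}:Z'\to Y'$ either (i.e., no Borel $G$-equivariant maps $\xi:Y'\to Z'$ with $\pi(\xi(y))=y$ for all $y\in Y'$).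
   Context: The semidirect product $H\rtimes_\tau G$ is $H\times G$ with the product topology and the operation $(h_1,g_1)(h_2,g_2)=(h_1\tau^{g_1}(h_2),g_1g_2)$. A subset $A$ of a Polish space has the Baire property if $A\mathbin{\triangle}U$ is meager for some open set $U$. A continuous action of a Polish group on a Polish space is generically ergodic if every invariant set with the Baire property is either meager or comeager. *)

(* Defs.v *)
From HB Require Import structures.
From mathcomp Require Import all_boot all_order all_algebra.
From mathcomp Require Import all_classical all_reals all_analysis.

Set Implicit Arguments.
Unset Strict Implicit.
Unset Printing Implicit Defensive.

Local Open Scope classical_set_scope.
Local Open Scope group_scope.

Definition separable (T : topologicalType) :=
  exists2 D : set T, countable D & dense D.

Definition completely_metrizable (R : realType) (T : topologicalType) :=
  exists (M : metricType R) (f : T -> M) (g : M -> T),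
    [/\ cancel f g, cancel g f, continuous f, continuous g &
        forall F : set_system M, ProperFilter F -> cauchy F ->
          exists x : M, F --> x].

Definition polish (R : realType) (T : topologicalType) :=
  separable T /\ completely_metrizable R T.

Notation borel T := (g_sigma_algebraType (@open T)).

Definition standard_borel (R : realType) (d : measure_display)
    (Y : measurableType d) :=
  exists (P : ptopologicalType) (f : Y -> borel P) (g : borel P -> Y),
    [/\ polish R P, cancel f g, cancel g f,
        measurable_fun setT f & measurable_fun setT g].

Section category.
Variable T : topologicalType.
Implicit Type A : set T.

Definition nowhere_dense A := (closure A)° = set0.

Definition meager A :=
  exists2 F : nat -> set T,
    (forall n, nowhere_dense (F n)) & A = \bigcup_n F n.

Definition comeager A := meager (~` A).

Definition baire_property A := exists2 U, open U & meager (A `+` U).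

End category.

HB.mixin Record isTopologicalGroup G of Group G & Topological G := {
  mulg_continuous : continuous (fun p : G * G => p.1 * p.2) ;
  invg_continuous : continuous (fun x : G => x^-1)
}.

(* The distinguished point is arbitrary; it is there only because measurable
   types are pointed. *)
#[short(type="topGroupType")]
HB.structure Definition TopologicalGroup :=
  { G of PointedTopological G & Group G & isTopologicalGroup G }.

Section actions.
Variable G : groupType.

Definition is_action (X : Type) (a : G -> X -> X) :=
  (forall x, a 1 x = x) /\ (forall g h x, a (g * h) x = a g (a h x)).

Definition free_action (X : Type) (a : G -> X -> X) :=
  forall g x, a g x = x -> g = 1.

Definition invariant_set (X : Type) (a : G -> X -> X) (A : set X) :=
  forall g x, A x -> A (a g x).

Definition generically_ergodic (X : topologicalType) (a : G -> X -> X) :=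
  forall A, invariant_set a A -> baire_property A -> meager A \/ comeager A.

End actions.

Definition continuous_action (G : topGroupType) (X : topologicalType)
    (a : G -> X -> X) :=
  is_action a /\ continuous (fun p : G * X => a p.1 p.2).

Definition borel_action (G : topGroupType) (d : measure_display)
    (Y : measurableType d) (a : G -> Y -> Y) :=
  is_action a /\
  measurable_fun setT (fun p : borel G * Y => a p.1 p.2).

Record aut_action (G H : topGroupType) := AutAction {
  aut_act :> G -> H -> H ;
  aut_act_continuous_action : continuous_action aut_act ;
  aut_actM : forall g, {morph aut_act g : x y / x * y}
}.

Definition semidirect (G H : topGroupType) (tau : aut_action G H) : Type :=
  (H * G)%type.

Section semidirect.
Variables (G H : topGroupType) (tau : aut_action G H).
Local Notation S := (semidirect tau).

Definition semidirect_one : S := (1, 1).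
Definition semidirect_mul (p q : S) : S := (p.1 * tau p.2 q.1, p.2 * q.2).
Definition semidirect_inv (p : S) : S := (tau p.2^-1 p.1^-1, p.2^-1).

Let tau1 h : tau 1 h = h. Proof. by have [[]] := aut_act_continuous_action tau. Qed.
Let tauM g g' h : tau (g * g') h = tau g (tau g' h).
Proof. by have [[]] := aut_act_continuous_action tau. Qed.
Let tau_cont : continuous (fun p : G * H => tau p.1 p.2).
Proof. by have [] := aut_act_continuous_action tau. Qed.
Let taug1 g : tau g 1 = 1.
Proof. by apply: (mulgI (tau g 1)); rewrite -aut_actM !mulg1. Qed.

Let mulA : associative semidirect_mul.
Proof.
by move=> p q r; congr pair; rewrite /= ?aut_actM ?tauM mulgA.
Qed.
Let mul1 : left_id semidirect_one semidirect_mul.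
Proof. by case=> h g; congr pair; rewrite /= ?tau1 mul1g. Qed.
Let mulr1 : right_id semidirect_one semidirect_mul.
Proof. by case=> h g; congr pair; rewrite /= ?taug1 mulg1. Qed.
Let mulV : left_inverse semidirect_one semidirect_inv semidirect_mul.
Proof.
by case=> h g; congr pair; rewrite /= -?aut_actM mulVg ?taug1.
Qed.
Let mulVr : right_inverse semidirect_one semidirect_inv semidirect_mul.
Proof.
by case=> h g; congr pair; rewrite /= -?tauM mulgV ?tau1 ?mulgV.
Qed.

HB.instance Definition _ := Pointed.copy S (H * G)%type.
HB.instance Definition _ := Topological.copy S (H * G)%type.
HB.instance Definition _ := isGroup.Build S mulA mul1 mulr1 mulV mulVr.

Let pair_cvg (A B C : topologicalType) (f : A -> B) (g : A -> C) :
  continuous f -> continuous g -> continuous (fun x => (f x, g x)).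
Proof. by move=> cf cg x; apply: cvg_pair; [exact: cf|exact: cg]. Qed.

Let comp_cont (A B C : topologicalType) (f : A -> B) (g : B -> C) :
  continuous f -> continuous g -> continuous (fun x => g (f x)).
Proof. by move=> cf cg x; apply: continuous_comp; [exact: cf|exact: cg]. Qed.

Let fstc (A B : topologicalType) : continuous (fun p : A * B => p.1).
Proof. by move=> x; exact: cvg_fst. Qed.
Let sndc (A B : topologicalType) : continuous (fun p : A * B => p.2).
Proof. by move=> x; exact: cvg_snd. Qed.

Let mul_cont : continuous (fun p : S * S => p.1 * p.2).
Proof.
have c11 : continuous (fun p : S * S => p.1.1).
  exact: (comp_cont (@fstc S S) (@fstc H G)).
have c12 : continuous (fun p : S * S => p.1.2).
  exact: (comp_cont (@fstc S S) (@sndc H G)).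
have c21 : continuous (fun p : S * S => p.2.1).
  exact: (comp_cont (@sndc S S) (@fstc H G)).
have c22 : continuous (fun p : S * S => p.2.2).
  exact: (comp_cont (@sndc S S) (@sndc H G)).
have ct := comp_cont (pair_cvg c12 c21) tau_cont.
apply: (@pair_cvg _ H G).
  exact: (comp_cont (pair_cvg c11 ct) (@mulg_continuous H)).
exact: (comp_cont (pair_cvg c12 c22) (@mulg_continuous G)).
Qed.

Let inv_cont : continuous (fun p : S => p^-1).
Proof.
have c1 := comp_cont (@fstc H G) (@invg_continuous H).
have c2 := comp_cont (@sndc H G) (@invg_continuous G).
apply: (@pair_cvg _ H G) => //.
exact: (comp_cont (pair_cvg c2 c1) tau_cont).
Qed.

HB.instance Definition _ := isTopologicalGroup.Build S mul_cont inv_cont.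

End semidirect.

(* [xi] is total, but only its restriction to [D] is constrained. Borel means
   Borel for the trace on [D] of the sigma-algebra of [Y]: [measurable_fun D xi]
   would be vacuous when [D] is not measurable. *)
Definition borel_equivariant_inverse (G : Type) (Z : ptopologicalType)
    (d : measure_display) (Y : measurableType d)
    (aZ : G -> Z -> Z) (aY : G -> Y -> Y) (pi : Z -> Y)
    (D : set Y) (E : set Z) (xi : Y -> Z) :=
  [/\ forall y, D y -> E (xi y),
      forall B : set (borel Z), measurable B ->
        strace measurable D (D `&` xi @^-1` B),
      forall g y, D y -> xi (aY g y) = aZ g (xi y) &
      forall y, D y -> pi (xi y) = y].

(* Main.v *)
Require Import Defs.
From mathcomp Require Import all_boot all_order all_algebra.
From mathcomp Require Import all_classical all_reals all_analysis.
From mathcomp Require Import ring.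

Import Order.TTheory GRing.Theory Num.Theory.

Local Open Scope classical_set_scope.
Local Open Scope group_scope.

(** Suppose that xi is a Borel equivariant inverse over a G-invariant set D of
    values of pi whose preimage D' is comeager. For z in D', the points z and
    xi (pi z) have the same image under pi, so z = f z . xi (pi z) for a unique
    f z in H. The relation g . (h . z) = tau g h . (g . z), which comes from the
    semidirect product, makes f equivariant: f (g . z) = tau g (f z). Also
    f (h . z) = h * f z. Let A be a tau-invariant set with the Baire property
    that is neither meager nor comeager in H. Its preimage under f is
    G-invariant, and it contradicts the generic ergodicity of G on Z as soon as
    taking preimages under f
    - keeps the Baire property (coordinate_preimage_baire), and
    - turns nonmeager sets into nonmeager sets (meager_of_coordinate_preimage,
      applied to A and to its complement).

    The second point, and the fact that preimages of meager sets are meager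
    (coordinate_preimage_meager), are Kuratowski-Ulam arguments along the orbits
    of H: a meager set of Z is meager in almost every orbit (meager_orbit_maps),
    and f restricted to an orbit parametrized by H is a right translation.

    With this, the first point reduces to preimages of closed sets C. The graph
    of f is given by the equation z = h . s z, where s z = xi (pi z), so the
    preimage of C is a projection along H. Now s is continuous off a meager set
    (baire_property_continuous_off_meager), hence the equation is closed above
    almost every z, and the projection along H of such a set is the result of a
    Souslin scheme, which keeps the Baire property (baire_property_souslin,
    baire_property_proj). *)

(** * Meager sets and the Baire property *)

Lemma nowhere_denseP (T : topologicalType) (A : set T) :
  nowhere_dense A <->
  forall U, open U -> U !=set0 ->
    exists V, [/\ open V, V !=set0, V `<=` U & V `<=` ~` A].
Proof.
split=> [ndA U Uo [x Ux]|ndA].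
  exists (U `\` closure A); split.
  - by rewrite setDE; apply: openI => //; apply: closed_openC; exact: closed_closure.
  - apply: contrapT => /set0P/negP/negPn/eqP UA0.
    have : (closure A)° x.
      rewrite /interior; apply: (filterS _ (open_nbhs_nbhs (conj Uo Ux))).
      move=> y Uy; apply: contrapT => nAy.
      by have : (U `\` closure A) y by []; rewrite UA0.
    by rewrite ndA.
  - by move=> y [].
  - by move=> y [_ nAy] Ay; apply: nAy; exact: subset_closure.
rewrite /nowhere_dense -subset0 => x Ix.
have [V [Vo [y Vy] VU VA]] := ndA _ (open_interior (closure A)) (ex_intro _ x Ix).
have /interior_subset/(_ V) := VU _ Vy.
by case=> [|w [Aw /VA]]; first exact: open_nbhs_nbhs.
Qed.

Lemma nowhere_dense_sub (T : topologicalType) (A B : set T) :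
  A `<=` B -> nowhere_dense B -> nowhere_dense A.
Proof.
move=> AB /nowhere_denseP ndB; apply/nowhere_denseP => U Uo U0.
have [V [? ? ? VB]] := ndB U Uo U0.
by exists V; split=> // x /VB nBx /AB.
Qed.

Lemma meager_sub (T : topologicalType) (A B : set T) :
  A `<=` B -> meager B -> meager A.
Proof.
move=> AB [F ndF BF]; exists (fun n => F n `&` A) => [n|].
  by apply: nowhere_dense_sub (ndF n) => x [].
apply/seteqP; split=> [x Ax|x [n _ []//]].
by have [n _ Fx] : (\bigcup_n F n) x; [rewrite -BF; exact: AB|exists n].
Qed.

Lemma meager_bigcup (T : topologicalType) (I : countType) (F : I -> set T) :
  (forall i, meager (F i)) -> meager (\bigcup_i F i).
Proof.
move=> mF.
have /choice[E ndE] i : exists E : nat -> set T,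
    (forall n, nowhere_dense (E n)) /\ F i = \bigcup_n E n.
  by have [E] := mF i; exists E.
have nd0 : nowhere_dense (set0 : set T) by rewrite /nowhere_dense closure0 interior0.
exists (fun k => if unpickle k is Some p then E p.1 p.2 else set0).
  by move=> k; case: unpickle => // p; exact: (ndE _).1.
apply/seteqP; split=> [x [i _]|x [k _]].
  rewrite (ndE i).2 => -[n _ Ex].
  by exists (pickle (i, n)) => //; rewrite pickleK.
by case: unpickle => // p Ex; exists p.1 => //; rewrite (ndE _).2; exists p.2.
Qed.

Lemma nowhere_dense_meager (T : topologicalType) (A : set T) :
  nowhere_dense A -> meager A.
Proof.
move=> ndA; exists (fun=> A) => //.
by apply/seteqP; split=> [x Ax|x [] //]; exists 0%N.
Qed.

Lemma nowhere_dense_closure (T : topologicalType) (A : set T) :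
  nowhere_dense A -> nowhere_dense (closure A).
Proof. by rewrite /nowhere_dense -(iffLR (closure_id _) (@closed_closure _ A)). Qed.

Lemma meager0 (T : topologicalType) : meager (set0 : set T).
Proof. by apply: nowhere_dense_meager; rewrite /nowhere_dense closure0 interior0. Qed.

Lemma meagerU (T : topologicalType) (A B : set T) :
  meager A -> meager B -> meager (A `|` B).
Proof.
move=> mA mB; apply: (@meager_sub _ _ (\bigcup_b if b then A else B)).
  by move=> x [Ax|Bx]; [exists true|exists false].
by apply: meager_bigcup => -[].
Qed.

(** Homeomorphisms preserve meagerness; this is applied to the maps of an action
    and to the translations of a group. *)
Lemma meager_preimage (S T : topologicalType) (f : S -> T) (g : T -> S)
    (A : set T) :
  cancel f g -> cancel g f -> continuous f -> continuous g ->
  meager A -> meager (f @^-1` A).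
Proof.
move=> fK gK fc gc [F ndF ->]; exists (fun n => f @^-1` F n) => [n|]; last first.
  by rewrite preimage_bigcup.
apply/nowhere_denseP => U Uo [x Ux].
have /nowhere_denseP/(_ (g @^-1` U)) := ndF n.
case=> [||V [Vo [y Vy] VU VF]].
- by apply: open_comp => // ? _; exact: gc.
- by exists (f x); rewrite /= fK.
exists (f @^-1` V); split.
- by apply: open_comp => // ? _; exact: fc.
- by exists (g y); rewrite /= gK.
- by move=> z /VU; rewrite /= fK.
- by move=> z /VF.
Qed.

Lemma baire_property_eqmeager (T : topologicalType) (A B : set T) :
  baire_property A -> meager (A `+` B) -> baire_property B.
Proof.
move=> [U Uo mAU] mAB; exists U => //.
apply: meager_sub (meagerU _ _ _ mAU mAB) => x /=.
by have [?|?] := pselect (A x); have [?|?] := pselect (B x); rewrite /setY/=; tauto.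
Qed.

Lemma open_baire_property (T : topologicalType) (U : set T) :
  open U -> baire_property U.
Proof. by move=> Uo; exists U => //; rewrite setYK; exact: meager0. Qed.

(** If A is U up to a meager set, its complement is the complement of the
    closure of U up to a meager set, because the boundary of an open set is
    nowhere dense. *)
Lemma baire_propertyC (T : topologicalType) (A : set T) :
  baire_property A -> baire_property (~` A).
Proof.
move=> [U Uo mAU]; exists (~` closure U).
  by apply: closed_openC; exact: closed_closure.
have ndU : nowhere_dense (closure U `\` U).
  apply/nowhere_denseP => V Vo [x Vx].
  have [[y [Uy Vy]]|UV0] := pselect (U `&` V !=set0).
    exists (U `&` V); split; first exact: openI.
    - by exists y.
    - by move=> z [].
    - by move=> z [Uz _] [].
  exists V; split=> //; first by exists x.
  move=> z Vz [Uz _]; apply: UV0; apply: (Uz V).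
  exact: open_nbhs_nbhs.
apply: meager_sub (meagerU _ _ _ mAU (nowhere_dense_meager _ _ ndU)) => x.
have := @subset_closure _ U x.
by have [?|?] := pselect (closure U x); have [?|?] := pselect (A x);
  have [?|?] := pselect (U x);
  rewrite /setY /setC/=; tauto.
Qed.

Lemma closed_baire_property (T : topologicalType) (A : set T) :
  closed A -> baire_property A.
Proof.
move=> Ac; rewrite -[A]setCK; apply: baire_propertyC.
by apply: open_baire_property; exact: closed_openC.
Qed.

Lemma baire_property_bigcup (T : topologicalType) (F : nat -> set T) :
  (forall n, baire_property (F n)) -> baire_property (\bigcup_n F n).
Proof.
move=> bF.
have /choice[U UF] n : exists U, open U /\ meager (F n `+` U).
  by have [U] := bF n; exists U.
exists (\bigcup_n U n); first by apply: bigcup_open => n _; exact: (UF n).1.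
apply: meager_sub (meager_bigcup _ _ _ (fun n => (UF n).2)) => x.
case=> -[[n _ Fx] nx]; exists n => //.
  by left; split=> // Ux; apply: nx; exists n.
by right; split=> // Ux; apply: nx; exists n.
Qed.

Lemma baire_propertyI (T : topologicalType) (A B : set T) :
  baire_property A -> baire_property B -> baire_property (A `&` B).
Proof.
move=> bA bB; rewrite -[A `&` B]setCK; apply: baire_propertyC.
have -> : ~` (A `&` B) = \bigcup_n (if n is 0%N then ~` A else ~` B).
  rewrite setCI; apply/seteqP; split=> x.
    by case=> ?; [exists 0%N|exists 1%N].
  by case=> -[|n] _; [left|right].
by apply: baire_property_bigcup => -[|_]; exact: baire_propertyC.
Qed.

Lemma borel_baire_property (T : ptopologicalType) (B : set (borel T)) :
  measurable B -> baire_property (B : set T).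
Proof.
apply: smallest_sub => [|U]; last exact: open_baire_property.
split=> [|A bA|F bF].
- by apply: open_baire_property; exact: open0.
- by rewrite setTD; exact: baire_propertyC.
- exact: baire_property_bigcup.
Qed.

(** * Polish spaces and the Baire category theorem *)

(** The countable combinatorial trace of a complete separable metric: W i j
    plays the role of the ball of radius 1/(i+1) around the j-th point of a dense
    sequence. A filter that contains a member of each level is Cauchy,
    hence converges; the closure in the third clause builds in regularity. *)
Definition complete_base (T : topologicalType) (W : nat -> nat -> set T) :=
  [/\ forall i j, open (W i j),
      forall i x, exists j, W i j x,
      forall x U, nbhs x U ->
        exists i, forall j, W i j x -> closure (W i j) `<=` U &
      forall F : set_system T, ProperFilter F ->
        (forall i, exists j, F (W i j)) -> exists x : T, F --> x].

Lemma polish_complete_base (R : realType) (T : ptopologicalType) :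
  polish R T -> exists W : nat -> nat -> set T, complete_base T W.
Proof.
move=> [[D /pcard_surjP[e De] dD] [M [f [g [fK gK fc gc Mc]]]]].
pose r (i : nat) : R := (i.+1%:R^-1)%R.
have r0 i : (0 < r i)%R by rewrite invr_gt0.
pose W i j := (f @^-1` ball (f (e j)) (r i))°.
have Wball i j x : W i j x -> ball (f (e j)) (r i) (f x).
  by move=> /interior_subset.
have Dnear x (eps : R) : (0 < eps)%R -> exists j, ball (f x) eps (f (e j)).
  move=> eps0; have fx : nbhs x (f @^-1` ball (f x) eps).
    by apply: fc; exact: nbhsx_ballx.
  have [|y [Iy /De[j _ ejy]]] := dD _ _ (open_interior (f @^-1` ball (f x) eps)).
    by exists x.
  by exists j; move/interior_subset: Iy; rewrite -ejy.
exists W; split.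
- by move=> i j; exact: open_interior.
- move=> i x; have r20 : (0 < r i / 2)%R by rewrite divr_gt0.
  have [j xj] := Dnear x _ r20; exists j.
  apply: (@filterS _ _ _ (f @^-1` ball (f x) (r i / 2))) => [y xy|].
    rewrite /preimage/= (splitr (r i)).
    by apply: ball_triangle xy; exact: ball_sym.
  by apply: fc; exact: nbhsx_ballx.
- move=> x U xU.
  have : nbhs (f x) (g @^-1` U) by apply: gc; rewrite fK.
  move=> /nbhs_ballP[eps /= eps0 epsU].
  have eps30 : (0 < eps / 3)%R by rewrite divr_gt0.
  have [i _ /(_ i (leqnn i)) /= ri] := near_infty_natSinv_lt (PosNum eps30).
  exists i => j /Wball jx y clWy; rewrite -[y]fK; apply: epsU.
  have : nbhs y (f @^-1` ball (f y) (r i)) by apply: fc; exact: nbhsx_ballx.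
  move=> /clWy[w [/Wball jw yw]].
  (* from f x to the centre, then to a point w of W i j near y, then to y *)
  apply: (@le_ball _ _ _ (r i + r i + r i)%R).
    have -> : (eps = eps / 3 + eps / 3 + eps / 3)%R by field.
    by rewrite !lerD// ltW.
  apply: (@ball_triangle _ _ (f w)); last exact: ball_sym.
  by apply: ball_triangle jw; exact: ball_sym.
- move=> F PF FW.
  have : cauchy (f @ F).
    apply: (@cauchy_exP _ _ (f @ F)) => eps eps0.
    have [i _ /(_ i (leqnn i)) /= ri] := near_infty_natSinv_lt (PosNum eps0).
    have [j Fj] := FW i; exists (f (e j)); apply: filterS Fj => x /Wball.
    by apply: le_ball; exact: ltW.
  move=> /(Mc _ (fmap_proper_filter f PF))[x fFx]; exists (g x) => U /gc/fFx.
  by apply: (@filterS _ F) => y /=; rewrite fK.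
Qed.

Lemma polish_hausdorff (R : realType) (T : topologicalType) :
  polish R T -> hausdorff_space T.
Proof.
move=> [_ [M [f [g [fK gK fc gc _]]]]] x y xy; rewrite -[x]fK -[y]fK; congr g.
apply: metric_hausdorff => A B /fc fA /fc fB.
by have [z [Az Bz]] := xy _ _ fA fB; exists (f z).
Qed.

(** Baire category theorem. Shrink U step by step to open sets V n, each with
    closure inside the previous one, disjoint from the n-th nowhere dense set and
    contained in a set of level n; they generate a convergent filter, whose limit
    lies in U and escapes all the nowhere dense sets. *)
Lemma complete_base_baire (T : topologicalType) (W : nat -> nat -> set T)
    (U : set T) :
  complete_base T W -> open U -> meager U -> U = set0.
Proof.
move=> [Wo Wc Wcl Wcvg] Uo [N ndN UN].
apply: contrapT => /eqP/set0P U0.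
have /choice[next nextP] (p : nat * set T) : exists V' : set T,
    open p.2 -> p.2 !=set0 -> [/\ open V', V' !=set0, closure V' `<=` p.2,
      V' `<=` ~` N p.1 & exists j, V' `<=` W p.1 j].
  case: p => n V /=.
  have [[Vo V0]|nV] := pselect (open V /\ V !=set0); last by exists set0 => ? ?; case: nV.
  have /nowhere_denseP/(_ V Vo V0)[V1 [V1o [x V1x] V1V V1N]] := ndN n.
  have [i iP] := Wcl x V1 (open_nbhs_nbhs (conj V1o V1x)).
  have [j Wj] := Wc i x; have [k Wk] := Wc n x.
  exists (W i j `&` W n k) => _ _; split.
  - exact: openI.
  - by exists x.
  - by move=> y /closureI[/(iP _ Wj)/V1V].
  - by move=> y [/subset_closure/(iP _ Wj)/V1N].
  - by exists k => y [].
pose V := fix V n := if n is m.+1 then next (m, V m) else U.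
have VP n : open (V n) /\ V n !=set0.
  by elim: n => [//|n [Vo V0]]; have [] := nextP (n, V n) Vo V0.
have VSP n := nextP (n, V n) (VP n).1 (VP n).2.
have Vdecr m n : (m <= n)%N -> V n `<=` V m.
  elim: n => [|n IH]; first by rewrite leqn0 => /eqP ->.
  rewrite leq_eqVlt => /orP[/eqP -> //|/IH Vnm].
  apply: subset_trans Vnm; have [_ _ VV _ _] := VSP n.
  by apply: subset_trans VV; exact: subset_closure.
have FF : ProperFilter (filter_from setT V).
  apply: filter_from_proper => [|n _]; last exact: (VP n).2.
  apply: filter_from_filter; first by exists 0%N.
  move=> m n _ _; exists (maxn m n) => // x Vx.
  by split; apply: Vdecr Vx; rewrite ?leq_maxl ?leq_maxr.
have [|x Fx] := Wcvg _ FF.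
  move=> i; have [_ _ _ _ [j Vj]] := VSP i.
  by exists j; exists i.+1.
have clVx n : closure (V n) x.
  move=> B /Fx[m _ VB]; have [y Vy] := (VP (maxn m n)).2.
  by exists y; split; [|apply: VB]; apply: Vdecr Vy; rewrite ?leq_maxl ?leq_maxr.
have Vx n : V n x by have [_ _ VV _ _] := VSP n; apply: VV; exact: clVx n.+1.
have : U x by exact: (Vx 0%N).
rewrite UN => -[n _]; have [_ _ _ + _] := VSP n; apply; exact: Vx n.+1.
Qed.

(** * The Souslin operation, projections, and continuity off a meager set *)

Definition countable_base (T : topologicalType) (B : nat -> set T) :=
  (forall n, open (B n)) /\
  forall x U, nbhs x U -> exists2 n, B n x & B n `<=` U.

Lemma complete_base_countable_base (T : topologicalType) (W : nat -> nat -> set T) :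
  complete_base T W -> exists B : nat -> set T, countable_base T B.
Proof.
move=> [Wo Wc Wcl _].
exists (fun k => if unpickle k is Some p then W p.1 p.2 else set0); split.
  by move=> k; case: unpickle => [p|]; [exact: Wo|exact: open0].
move=> x U xU; have [i iU] := Wcl x U xU; have [j Wj] := Wc i x.
exists (pickle (i, j)); rewrite pickleK//=.
by move=> y /subset_closure; exact: iU.
Qed.

(** The closed hull of S modulo meager sets: up to a meager set, S is contained
    in heavy S, and heavy S is the smallest such closed set. *)
Definition heavy (T : topologicalType) (S : set T) : set T :=
  [set x | forall U, open U -> U x -> ~ meager (S `&` U)].

Lemma closed_heavy (T : topologicalType) (S : set T) : closed (heavy T S).
Proof.
move=> x clx U Uo Ux mSU.
have [y [/(_ U Uo) + Uy]] := clx U (open_nbhs_nbhs (conj Uo Ux)).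
by apply.
Qed.

Lemma heavy_closure (T : topologicalType) (S : set T) : heavy T S `<=` closure S.
Proof.
move=> x hx U /nbhs_interior xU; apply: contrapT => SU0.
apply: (hx U°); [exact: open_interior|exact: nbhs_singleton|].
apply: meager_sub (meager0 T) => y [Sy /interior_subset Uy].
by apply: SU0; exists y.
Qed.

Lemma meager_heavyD (T : topologicalType) (B : nat -> set T) (S : set T) :
  countable_base T B -> meager (S `\` heavy T S).
Proof.
move=> [Bo Bb].
pose F n := [set x | S x /\ B n x /\ meager (S `&` B n)].
apply: (meager_sub _ _ (\bigcup_n F n)) => [x [Sx nhx]|].
  have [U nU] : exists U, ~ (open U -> U x -> ~ meager (S `&` U)).
    by apply: contrapT => nU; apply: nhx => U; apply: contrapT => ?; apply: nU; exists U.
  move: nU => /not_implyP[Uo /not_implyP[Ux /contrapT mSU]].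
  have [n Bx BU] := Bb x U (open_nbhs_nbhs (conj Uo Ux)).
  exists n => //; split=> //; split=> //.
  by apply: meager_sub mSU => y [Sy /BU].
apply: meager_bigcup => n.
have [mS|nmS] := pselect (meager (S `&` B n)).
  by apply: meager_sub mS => x [Sx [Bx _]].
by apply: meager_sub (meager0 T) => x [_ [_ /nmS]].
Qed.

(** Up to a meager set, the hulls of countably many sets cover the hull of their
    union. The difference, V in the proof, has the Baire property, so it is an
    open U up to a meager set; S is meager on V, hence on U, so U misses heavy S
    and V is meager. *)
Lemma meager_heavy_bigcup (T : topologicalType) (B : nat -> set T)
    (S : set T) (F : nat -> set T) :
  countable_base T B -> S `<=` \bigcup_n F n ->
  meager (heavy T S `\` \bigcup_n heavy T (F n)).
Proof.
move=> Bb SF; set V := _ `\` _.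
have bV : baire_property V.
  rewrite /V setDE; apply: baire_propertyI.
    by apply: closed_baire_property; exact: closed_heavy.
  apply: baire_propertyC; apply: baire_property_bigcup => n.
  by apply: closed_baire_property; exact: closed_heavy.
have mSV : meager (S `&` V).
  apply: (meager_sub _ _ (\bigcup_n (F n `\` heavy T (F n)))) => [x [/SF[n _ Fx] [_ nx]]|].
    by exists n => //; split=> // hx; apply: nx; exists n.
  by apply: meager_bigcup => n; apply: meager_heavyD Bb.
have [U Uo mVU] := bV.
have mSU : meager (S `&` U).
  apply: meager_sub (meagerU _ _ _ mSV mVU) => x [Sx Ux].
  by have [Vx|nVx] := pselect (V x); [left|right; right].
apply: meager_sub mVU => x Vx; left; split=> // Ux.
by case: Vx => /(_ U Uo Ux).
Qed.

(** Closure of the Baire property under the Souslin operation (Nikodym). Off N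
    and off the meager set where the hull of some node is not covered by those of
    its successors, a point in the hull of the root selects inductively a branch
    of the scheme along which it is in every hull, a fortiori in every closure.
    So the root agrees with its hull, a closed set, up to a meager set. *)
Lemma baire_property_souslin (T : topologicalType) (B : nat -> set T)
    (A : seq nat -> set T) (N : set T) :
  countable_base T B -> meager N ->
  (forall s, A s `<=` \bigcup_n A (rcons s n)) ->
  (forall (x : nat -> nat) z, ~ N z ->
     (forall n, closure (A (mkseq x n)) z) -> A [::] z) ->
  baire_property (A [::]).
Proof.
move=> Bb mN AS AN.
pose E s := heavy T (A s) `\` \bigcup_n heavy T (A (rcons s n)).
have mE : meager (\bigcup_s E s).
  by apply: meager_bigcup => s; apply: meager_heavy_bigcup Bb _; exact: AS.
apply: (@baire_property_eqmeager _ (heavy T (A [::]))).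
  by apply: closed_baire_property; exact: closed_heavy.
apply: meager_sub (meagerU _ _ _ (meagerU _ _ _ mN mE)
  (meager_heavyD _ _ (A [::]) Bb)) => z [[hz nAz]|Az]; last by right.
left; apply: contrapT => /not_orP[nNz nEz]; apply: nAz.
have /choice[nx nxP] s : exists n, heavy T (A s) z -> heavy T (A (rcons s n)) z.
  have [hsz|nhsz] := pselect (heavy T (A s) z); last by exists 0%N.
  apply: contrapT => nn; apply: nEz; exists s => //; split=> // -[n _ hn].
  by apply: nn; exists n.
pose t := fix t n := if n is m.+1 then rcons (t m) (nx (t m)) else [::].
pose x n := nx (t n).
have tE n : mkseq x n = t n by elim: n => // n IH; rewrite mkseqS IH.
have ht n : heavy T (A (t n)) z by elim: n => [//|n IH]; exact: nxP.
by apply: (AN x) => // n; rewrite tE; apply: heavy_closure.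
Qed.

(** Projecting along a complete factor: the points of the projection whose
    witness lies in W 0 s_0, W 1 s_1, ... form a Souslin scheme. If z is in the
    closure of every set along a branch x, the witnesses of points close to z
    generate a filter which the branch forces to converge, and its limit is a
    witness for z because Q is closed above z. *)
Lemma baire_property_proj (X H : topologicalType) (B : nat -> set X)
    (W : nat -> nat -> set H) (Q : set (X * H)) (N : set X) :
  countable_base X B -> complete_base H W -> meager N ->
  (forall z h, ~ N z -> closure Q (z, h) -> Q (z, h)) ->
  baire_property [set z | exists h, Q (z, h)].
Proof.
move=> Bb [Wo Wc Wcl Wcvg] mN Qcl.
pose A s := [set z | exists h, Q (z, h) /\
  forall i, (i < size s)%N -> W i (nth 0%N s i) h].
have -> : [set z | exists h, Q (z, h)] = A [::].
  by apply/seteqP; split=> z [h]; [exists h|case=> ?; exists h].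
apply: (baire_property_souslin _ _ _ N Bb mN) => [s z [h [Qzh sh]]|x z nNz clz].
  have [j Wj] := Wc (size s) h.
  exists j => //; exists h; split=> // i; rewrite size_rcons ltnS nth_rcons.
  by case: ltngtP => // [/sh//|->].
pose P (p : nat * set X) := [set h | (forall i, (i < p.1)%N -> W i (x i) h) /\
  exists2 z', p.2 z' & Q (z', h)].
pose D (p : nat * set X) := nbhs z p.2.
have PF : ProperFilter (filter_from D P).
  apply: filter_from_proper => [|[n U] /= zU]; last first.
    have [z' [[h [Qh sh]] Uz']] := clz n U zU.
    exists h; split; last by exists z'.
    move=> i ni; have := sh i; rewrite size_mkseq => /(_ ni).
    by rewrite nth_mkseq.
  apply: filter_from_filter; first by exists (0%N, setT); exact: filterT.
  move=> [m U] [n V] zU zV; exists (maxn m n, U `&` V); first exact: filterI.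
  move=> h [/= ih [z' [Uz' Vz'] Qz'h]]; split; split=> /=; try by exists z'.
  - by move=> i im; apply: ih; rewrite leq_max im.
  - by move=> i im; apply: ih; rewrite leq_max im orbT.
have [|h Fh] := Wcvg _ PF.
  move=> i; exists (x i); exists (i.+1, setT); first exact: filterT.
  by move=> h [/(_ i (ltnSn i))].
exists h; split=> //; apply: Qcl => // O [[U V] [/= zU hV] UVO].
have [[n U'] /= zU' PV] := Fh V hV.
have [h' [ih [z' [Uz' U'z'] Qz'h']]] : P (n, U `&` U') !=set0.
  by apply: (@filter_ex _ _ PF); exists (n, U `&` U') => //; exact: filterI.
exists (z', h'); split=> //; apply: UVO; split=> //=.
by apply: PV; split=> //; exists z'.
Qed.

(** A map whose preimages of open sets have the Baire property is continuous
    on the complement of a meager set, namely where every basic open set pulls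
    back exactly to the open set that approximates its preimage. *)
Lemma baire_property_continuous_off_meager (X Z : topologicalType) (B : nat -> set Z)
    (D : set X) (s : X -> Z) :
  countable_base Z B -> (forall U, open U -> baire_property (D `&` s @^-1` U)) ->
  exists2 N, meager N & forall z U, D z -> ~ N z -> nbhs (s z) U ->
    exists2 V, nbhs z V & forall z', V z' -> D z' -> ~ N z' -> U (s z').
Proof.
move=> [Bo Bb] sbp.
have /choice[V VP] n : exists V, open V /\ meager ((D `&` s @^-1` B n) `+` V).
  by have [V] := sbp _ (Bo n); exists V.
exists (\bigcup_n ((D `&` s @^-1` B n) `+` V n)).
  by apply: meager_bigcup => n; exact: (VP n).2.
move=> z U Dz nNz sU; have [n Bsz BU] := Bb _ _ sU.
have Vz : V n z.
  by apply: contrapT => nVz; apply: nNz; exists n => //; left.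
exists (V n); first by apply: open_nbhs_nbhs; split=> //; exact: (VP n).1.
move=> z' Vz' Dz' nNz'; apply: BU; apply: contrapT => nB.
by apply: nNz'; exists n => //; right; split=> // -[_ /nB].
Qed.

(** * Category along the orbits of a continuous action *)

Section continuous_action.
Variables (H : topGroupType) (Z : topologicalType) (a : H -> Z -> Z).
Hypothesis a_cont : continuous_action a.

Lemma act1 z : a 1 z = z. Proof. exact: a_cont.1.1. Qed.

Lemma actM g h z : a (g * h) z = a g (a h z). Proof. exact: a_cont.1.2. Qed.

Lemma actK h : cancel (a h) (a h^-1).
Proof. by move=> z; rewrite -actM mulVg act1. Qed.

Lemma continuous_act_point h : continuous (a h).
Proof.
move=> z; apply: (@continuous_comp _ _ _ (fun z => (h, z)) (fun p => a p.1 p.2)).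
  by apply: cvg_pair => //; exact: cvg_cst.
exact: a_cont.2.
Qed.

Lemma continuous_orbit_map z : continuous (a^~ z).
Proof.
move=> h; apply: (@continuous_comp _ _ _ (fun h => (h, z)) (fun p => a p.1 p.2)).
  by apply: cvg_pair => //; exact: cvg_cst.
exact: a_cont.2.
Qed.

Lemma meager_act h (M : set Z) : meager M -> meager (a h @^-1` M).
Proof.
apply: (meager_preimage _ _ _ (a h^-1)); try exact: continuous_act_point.
  exact: actK.
by rewrite -{2}[h]invgK; exact: actK.
Qed.

(** The Kuratowski-Ulam theorem along orbits: a meager set of Z is meager in
    almost every orbit, in the parametrization by the group. Since every h acts
    by a homeomorphism, asking that a whole nonempty basic open set of group
    elements carry z into the closure of F n is a nowhere dense condition on z. When z
    avoids these countably many conditions, the parameters h with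
    a h z in F n form a nowhere dense set. *)
Lemma meager_orbit_maps (B : nat -> set H) (M : set Z) :
  countable_base H B -> meager M ->
  meager [set z | ~ meager [set h | M (a h z)]].
Proof.
move=> [Bo Bb] [F ndF MF].
pose E (p : nat * nat) := [set z | B p.2 !=set0 /\
  forall h, B p.2 h -> closure (F p.1) (a h z)].
apply: (meager_sub _ _ (\bigcup_p E p)) => [z nmz|]; last first.
  apply: meager_bigcup => -[n k].
  have [[h Bh]|B0] := pselect (B k !=set0); last first.
    by apply: meager_sub (meager0 _) => z [/B0].
  apply: (meager_sub _ _ (a h @^-1` closure (F n))) => [z [_ /(_ h Bh)]//|].
  apply: meager_act; apply: nowhere_dense_meager.
  exact: nowhere_dense_closure.
apply: contrapT => nEz; apply: nmz; rewrite MF.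
exists (fun n => [set h | F n (a h z)]) => [n|]; last first.
  by apply/seteqP; split=> h [n _ Fn]; exists n.
apply/nowhere_denseP => U Uo [h Uh].
have [k Bh BU] := Bb h U (open_nbhs_nbhs (conj Uo Uh)).
have [h' Bh' nFh'] : exists2 h', B k h' & ~ closure (F n) (a h' z).
  apply: contrapT => nh'; apply: nEz; exists (n, k) => //; split; first by exists h.
  by move=> h' Bh'; apply: contrapT => ?; apply: nh'; exists h'.
exists (U `&` (a^~ z @^-1` (~` closure (F n)))); split.
- apply: openI => //; apply: open_comp => [x _|]; first exact: continuous_orbit_map.
  by apply: closed_openC; exact: closed_closure.
- by exists h'; split=> //; exact: BU.
- by move=> x [].
- by move=> x [_ /= nFx] Fx; apply: nFx; exact: subset_closure.
Qed.

End continuous_action.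

Lemma meager_mulr (H : topGroupType) (k : H) (M : set H) :
  meager M -> meager [set h | M (h * k)].
Proof.
have cM (l : H) : continuous (fun h : H => h * l).
  move=> h; apply: (@continuous_comp _ _ _ (fun h => (h, l)) (fun p => p.1 * p.2)).
    by apply: cvg_pair => //; exact: cvg_cst.
  exact: mulg_continuous.
apply: (meager_preimage _ _ (fun h => h * k) (fun h => h * k^-1)) => //.
  by move=> h; rewrite mulgK.
by move=> h; rewrite mulgVK.
Qed.

(** * The coordinate in a free orbit *)

Section coordinate.
(* A free H-space Z with an orbit selector s on a comeager set D of orbits, and
   the resulting coordinate f : D -> H of a point relative to the selected point
   of its orbit. *)
Variables (R : realType) (H : topGroupType) (Z : ptopologicalType).
Hypotheses (polH : polish R H) (polZ : polish R Z).
Variable (a : H -> Z -> Z).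
Hypotheses (a_cont : continuous_action a) (a_free : free_action a).
Variables (D : set Z) (s : Z -> Z) (f : Z -> H).
Hypotheses (D_comeager : comeager D)
  (D_inv : forall h z, D z -> D (a h z))
  (s_inv : forall h z, D z -> s (a h z) = s z)
  (s_bp : forall U, open U -> baire_property (D `&` s @^-1` U))
  (fP : forall z, D z -> z = a (f z) (s z)).

Lemma coordinate_unique z h : D z -> z = a h (s z) -> h = f z.
Proof.
move=> Dz zh; suff : (f z)^-1 * h = 1.
  by move/(congr1 (fun k => f z * k)); rewrite mulVKg mulg1.
apply: (a_free _ (s z)); rewrite (actM _ _ _ a_cont) -zh.
by have := congr1 (a (f z)^-1) (fP z Dz); rewrite (actK _ _ _ a_cont).
Qed.

Lemma coordinate_act h z : D z -> f (a h z) = h * f z.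
Proof.
move=> Dz; apply/esym/coordinate_unique; first exact: D_inv.
by rewrite s_inv// (actM _ _ _ a_cont) -fP.
Qed.

Lemma comeager_baire_property : baire_property D.
Proof.
apply: (baire_property_eqmeager _ _ _ (open_baire_property _ _ openT)).
by apply: meager_sub D_comeager => z [[_ nDz]|[_ []]].
Qed.

(** For z off a meager set, f z lies in C exactly when some h in C satisfies
    z = h . s z. As s is continuous off a meager set, this equation defines a set
    that is closed above almost every z, and its projection has the Baire
    property. *)
Lemma coordinate_preimage_closed C : closed C -> baire_property (D `&` f @^-1` C).
Proof.
move=> Cc; have [WZ WZP] := polish_complete_base _ _ polZ.
have [W WP] := polish_complete_base _ _ polH.
have [B Bb] := complete_base_countable_base _ _ WZP.
have [N mN Nc] := baire_property_continuous_off_meager _ _ _ _ _ Bb s_bp.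
pose Q := [set p : Z * H | [/\ D p.1, ~ N p.1, C p.2 & p.1 = a p.2 (s p.1)]].
apply: (@baire_property_eqmeager _ [set z | exists h, Q (z, h)]); last first.
  apply: meager_sub mN => z [[[h [/= Dz nNz Ch zh]] nfz]|[[Dz Cfz] nQ]].
    by case: nfz; split=> //=; rewrite -(coordinate_unique z h).
  by apply: contrapT => nNz; apply: nQ; exists (f z); split=> //=; exact: fP.
apply: (baire_property_proj _ _ _ _ _ (N `|` ~` D) Bb WP); first exact: meagerU.
move=> z h /not_orP[nNz /contrapT Dz] clQ.
split=> //=.
  apply: Cc => V hV.
  have [|[z' h'] [[_ _ Ch' _] [_ Vh']]] := clQ (setT `*` V).
    by exists (setT, V) => //; split=> //; exact: filterT.
  by exists h'.
apply: (polish_hausdorff _ _ polZ) => A A' zA zA'.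
have := a_cont.2 (h, s z) _ zA'.
move=> [[V1 V2] [/= hV1 sV2] V12].
have [V zV VP] := Nc z V2 Dz nNz sV2.
have [|[z' h'] [/= [/= Dz' nNz' _ z'h'] [/= [Az' Vz'] V1h']]] := clQ ((A `&` V) `*` V1).
  by exists (A `&` V, V1) => //; split=> //=; exact: filterI.
exists z'; split=> //; rewrite z'h'; apply: (V12 (h', s z')); split=> //=.
exact: VP.
Qed.

Lemma meager_trace_on_orbit M U : meager M -> open U -> U !=set0 ->
  exists z, [/\ U z, D z & meager [set h | M (a h z)]].
Proof.
move=> mM Uo [x Ux]; have [WZ WZP] := polish_complete_base _ _ polZ.
have [W WP] := polish_complete_base _ _ polH.
have [B Bb] := complete_base_countable_base _ _ WP.
apply: contrapT => nz.
have U0 : U = set0.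
  apply: (complete_base_baire _ _ _ WZP Uo).
  apply: meager_sub (meagerU _ _ _ D_comeager
    (meager_orbit_maps _ _ _ a_cont _ _ Bb mM)).
  move=> z Uz; have [Dz|nDz] := pselect (D z); last by left.
  by right=> mz; apply: nz; exists z.
by move: Ux; rewrite U0.
Qed.

(** Let P be the preimage of a closed nowhere dense set, approximated by an open
    U. If U is nonempty, the difference of P and U is meager on the orbit of some
    z in U. On that orbit P is a right translate of a meager set of H, because f
    is H-equivariant, whereas U is nonempty and open: this contradicts the Baire
    category theorem in H. *)
Lemma coordinate_preimage_meager M : meager M -> meager (D `&` f @^-1` M).
Proof.
have [W WP] := polish_complete_base _ _ polH.
move=> [F ndF MF].
apply: (meager_sub _ _ (\bigcup_n (D `&` f @^-1` closure (F n)))).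
  move=> z [Dz]; rewrite /preimage/= MF => -[n _ Fz]; exists n => //; split=> //.
  exact: subset_closure.
apply: meager_bigcup => n; set P := _ `&` _.
have [U Uo mPU] : baire_property P.
  by apply: coordinate_preimage_closed; exact: closed_closure.
suff U0 : U = set0 by rewrite U0 setY0 in mPU.
apply: contrapT => /eqP/set0P U0.
have [z [Uz Dz mz]] := meager_trace_on_orbit _ _ mPU Uo U0.
suff O0 : [set h | U (a h z)] = set0.
  have : [set h | U (a h z)] 1 by rewrite /= (act1 _ _ _ a_cont).
  by rewrite O0.
apply: (complete_base_baire _ _ _ WP).
  by apply: open_comp => // h _; exact: continuous_orbit_map.
have mF : meager [set h | closure (F n) (h * f z)].
  apply: meager_mulr; apply: nowhere_dense_meager.
  exact: nowhere_dense_closure.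
apply: meager_sub (meagerU _ _ _ mF mz) => h /= Uh.
have [[_ Ph]|nPh] := pselect (P (a h z)); last by right; right.
by left; rewrite -coordinate_act.
Qed.

(** On a single orbit where the preimage of A is meager, f identifies it with a
    right translate of A. *)
Lemma meager_of_coordinate_preimage A : meager (D `&` f @^-1` A) -> meager A.
Proof.
move=> mA; have [|z [_ Dz mz]] := meager_trace_on_orbit _ _ mA openT.
  by exists point.
apply: meager_sub (meager_mulr _ (f z)^-1 _ mz) => h Ah /=.
by split; [exact: D_inv|rewrite /= coordinate_act// mulgVK].
Qed.

Lemma coordinate_preimage_baire A :
  baire_property A -> baire_property (D `&` f @^-1` A).
Proof.
move=> [U Uo mAU].
apply: (@baire_property_eqmeager _ (D `&` ~` (D `&` f @^-1` (~` U)))).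
  apply: baire_propertyI; first exact: comeager_baire_property.
  by apply/baire_propertyC/coordinate_preimage_closed; exact: open_closedC.
apply: meager_sub (coordinate_preimage_meager _ mAU) => z.
have [?|?] := pselect (D z); have [?|?] := pselect (U (f z));
have [?|?] := pselect (A (f z)); rewrite /setY /setC/=; tauto.
Qed.

End coordinate.

(** * Equivariant Borel inverses *)

(** The common core of both claims: the coordinate f relative to the section
    z |-> xi (pi z) is G-equivariant, so it pulls an invariant witness against
    the generic ergodicity of tau back to one against that of G on Z. *)
Lemma no_borel_equivariant_inverse (R : realType)
    (G : topGroupType) (Z : ptopologicalType) (polZ : polish R Z)
    (aGZ : G -> Z -> Z)
    (d : measure_display) (Y : measurableType d) (aGY : G -> Y -> Y)
    (pi : Z -> Y)
    (pi_borel : measurable_fun [set: borel Z] (pi : borel Z -> Y))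
    (pi_equiv : forall g z, pi (aGZ g z) = aGY g (pi z))
    (H : topGroupType) (polH : polish R H)
    (aHZ : H -> Z -> Z) (aHZ_cont : continuous_action aHZ)
    (aHZ_free : free_action aHZ)
    (pi_orbits : forall z1 z2, pi z1 = pi z2 <-> exists h, z2 = aHZ h z1)
    (tau : aut_action G H)
    (aGHZ : forall g h z, aGZ g (aHZ h z) = aHZ (tau g h) (aGZ g z))
    (ergZ : generically_ergodic aGZ) (nergH : ~ generically_ergodic tau)
    (D : set Y) (E : set Z) (xi : Y -> Z) :
  invariant_set aGY D -> comeager (pi @^-1` D) ->
  ~ borel_equivariant_inverse aGZ aGY pi D E xi.
Proof.
move=> Dinv Dcom [_ xi_borel xi_equiv xiK].
pose D' := pi @^-1` D; pose s z := xi (pi z).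
have piH h z : pi (aHZ h z) = pi z.
  by apply/esym/pi_orbits; exists h.
have D'H h z : D' z -> D' (aHZ h z) by rewrite /D'/= piH.
have sH h z : D' z -> s (aHZ h z) = s z by rewrite /s piH.
have /choice[f fP] z : exists h, D' z -> z = aHZ h (s z).
  have [Dz|nDz] := pselect (D' z); last by exists 1.
  by have /pi_orbits[h zh] : pi (s z) = pi z; [exact: xiK|exists h].
have bD' : baire_property D' := comeager_baire_property _ D' Dcom.
have s_bp U : open U -> baire_property (D' `&` s @^-1` U).
  move=> Uo; have [|M mM DM] := xi_borel (U : set (borel Z)).
    exact: sub_sigma_algebra.
  have -> : D' `&` s @^-1` U = pi @^-1` M `&` D'.
    by rewrite -preimage_setI DM.
  apply: baire_propertyI => //; apply: borel_baire_property.
  by rewrite -[_ @^-1` _]setTI; apply: pi_borel.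
apply: nergH => A Ainv bA.
have fG g z : D' z -> f (aGZ g z) = tau g (f z).
  move=> Dz; apply/esym.
  have DGz : D' (aGZ g z) by rewrite /D'/= pi_equiv; exact: Dinv.
  apply: (coordinate_unique _ _ _ aHZ_cont aHZ_free D' s f fP) => //.
  by rewrite /s pi_equiv xi_equiv// -aGHZ -fP.
have [] := ergZ (D' `&` f @^-1` A).
- move=> g z [Dz Az]; split; first by rewrite /D'/= pi_equiv; exact: Dinv.
  by rewrite /= fG//; exact: Ainv.
- exact: (coordinate_preimage_baire _ _ _ polH polZ _ aHZ_cont aHZ_free D' s f
    Dcom D'H sH s_bp fP).
- move=> mA; left.
  exact: (meager_of_coordinate_preimage _ _ _ polH polZ _ aHZ_cont aHZ_free D' s f
    Dcom D'H sH fP).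
move=> cA; right.
apply: (meager_of_coordinate_preimage _ _ _ polH polZ _ aHZ_cont aHZ_free D' s f) => //.
by apply: meager_sub cA => z [_ nAz] [].
Qed.

Theorem theorem8p1 (R : realType)
    (G : topGroupType) (polG : polish R G)
    (Z : ptopologicalType) (polZ : polish R Z)
    (aGZ : G -> Z -> Z) (aGZ_cont : continuous_action aGZ)
    (d : measure_display) (Y : measurableType d) (stdY : standard_borel R Y)
    (aGY : G -> Y -> Y) (aGY_borel : borel_action aGY)
    (pi : Z -> Y)
    (pi_borel : measurable_fun [set: borel Z] (pi : borel Z -> Y))
    (pi_equiv : forall g z, pi (aGZ g z) = aGY g (pi z))
    (H : topGroupType) (polH : polish R H)
    (aHZ : H -> Z -> Z) (aHZ_cont : continuous_action aHZ)
    (aHZ_free : free_action aHZ)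
    (pi_orbits : forall z1 z2, pi z1 = pi z2 <-> exists h, z2 = aHZ h z1)
    (tau : aut_action G H)
    (aSZ : semidirect tau -> Z -> Z) (aSZ_cont : continuous_action aSZ)
    (aSZ_G : forall g z, aSZ (1, g) z = aGZ g z)
    (aSZ_H : forall h z, aSZ (h, 1) z = aHZ h z)
    (ergZ : generically_ergodic aGZ)
    (nergH : ~ generically_ergodic tau) :
  (~ exists xi : Y -> Z,
       borel_equivariant_inverse aGZ aGY pi (range pi) [set: Z] xi) /\
  (forall Y' : set Y,
     Y' `<=` range pi -> measurable Y' -> invariant_set aGY Y' ->
     comeager (pi @^-1` Y') ->
     ~ exists xi : Y -> Z,
         borel_equivariant_inverse aGZ aGY pi Y' (pi @^-1` Y') xi).
Proof.
(* in the semidirect product, (1, g) (h, 1) = (tau g h, 1) (1, g) *)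
have aGHZ g h z : aGZ g (aHZ h z) = aHZ (tau g h) (aGZ g z).
  rewrite -!aSZ_G -!aSZ_H -!(actM _ _ _ aSZ_cont).
  have tau1 : tau 1 1 = 1.
    by apply: (mulgI (tau 1 1)); rewrite -aut_actM !mulg1.
  congr (aSZ _ z); congr pair; rewrite /=.
  - by rewrite tau1 mul1g mulg1.
  - by rewrite mulg1 mul1g.
have main := no_borel_equivariant_inverse R G Z polZ aGZ d Y aGY pi pi_borel pi_equiv
  H polH aHZ aHZ_cont aHZ_free pi_orbits tau aGHZ ergZ nergH.
split=> [[xi]|Y' _ _ Y'inv Y'com [xi]]; last exact: main.
apply: main.
  by move=> g _ [z _ <-]; exists (aGZ g z).
rewrite /comeager (_ : ~` _ = set0); first exact: meager0.
by apply/seteqP; split=> z // nz; apply: nz; exists z.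
Qed.
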